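(* Let $(G_n)_{n\in\mathbb{N}}$ be an arbitrary family of $3$-regular connected undirected graphs, and for each $n$ let $\Gamma_n$ be the group of edge flips of $G_n$. There is a polynomial $p$ such that for every $n\in\mathbb{N}$ and every choice of $u_n\in V(G_n)$, there exists a $\Gamma_n$-symmetric IPS refutation over $\mathbb{F}_2$ of the unsatisfiable system $\mathrm{CFI}(G_n,u_n,1)$ which is not $\vec y$-linear and has size at most $p(|\mathrm{CFI}(G_n,u_n,1)|)$.
   Context: CFI equations: for a $3$-regular connected undirected graph $G=(V,E)$, a vertex $u\in V$ and $a\in\{0,1\}$, $\mathrm{CFI}(G,u,a)$ is the system over $\mathbb{F}_2$ with variables $X=\{x^e_i: e\in E, i\in\mathbb{F}_2\}$ and polynomials: $x^e_i+x^f_j+x^g_k-(i+j+k)$ for every $v\in V\setminus\{u\}$ with $\{e,f,g\}=E(v)$ (the edges incident to $v$) and every $i,j,k\in\mathbb{F}_2$; $x^e_i+x^f_j+x^g_k-(i+j+k+a)$ for $\{e,f,g\}=E(u)$ and every $i,j,k\in\mathbb{F}_2$; $x^e_0+x^e_1-1$ for every $e\in E$; and $x^2-x$ for every $x\in X$. It is unsatisfiable iff $a=1$. Its size is the number of polynomials plus $|X|$. The edge-flip group $\Gamma$ is the subgroup of $(\mathbb{F}_2^{E},+)$ of all vectors $\pi$ with $\sum_{e\in E(v)}\pi_e=0$ for every $v\in V$, acting on $X$ by $\pi(x^e_i)=x^e_{i+\pi_e}$; $\mathrm{CFI}(G,u,a)$ is $\Gamma$-invariant. An algebraic circuit over variables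 $Z$ and field $\mathbb{F}$ is a connected DAG with input gates labelled by elements of $Z\cup\mathbb{F}$ and internal gates labelled $+$ or $\times$ (arbitrary fan-in), single output, computing a polynomial. It is $\Gamma$-symmetric (for $\Gamma$ acting on $Z$, trivially on $\mathbb{F}$) if each $\pi\in\Gamma$ extends to a DAG automorphism preserving internal labels and mapping each input gate labelled $z$ to one labelled $\pi(z)$. IPS: for $\mathcal{F}=\{f_1,\dots,f_m\}$ and fresh $Y=\{y_1,\dots,y_m\}$, an IPS certificate is $C(\vec x,\vec y)$ with $C(\vec x,\vec 0)=0$, $C(\vec x,f_1,\dots,f_m)=1$; an IPS refutation is a circuit over $X\uplus Y$ computing one; its size is $\max(\text{number of gates},|X|+|Y|)$; it is $\vec y$-linear if the certificate is $\sum_iy_ig_i(\vec x)$. For $\Gamma$-invariant $\mathcal{F}$, $\Gamma$ acts on $Y$ by $\pi(y_i)=y_j$ where $\pi(f_i)=f_j$; a $\Gamma$-symmetric IPS refutation is one that is a $\Gamma$-symmetric circuit w.r.t. this action on $X\uplus Y$. *)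

(* Defs.v *)
From HB Require Import structures.
From mathcomp Require Import all_boot all_order all_algebra all_fingroup.
From mathcomp Require Import mpoly.

Set Implicit Arguments.
Unset Strict Implicit.
Unset Printing Implicit Defensive.

Import GRing.Theory.
Local Open Scope ring_scope.

(** Polynomials whose variables are indexed by a finite type *)

Definition fvar (F : fieldType) (Z : finType) (z : Z) : {mpoly F[#|Z|]} :=
  'X_(enum_rank z).

Definition fsubst (F : fieldType) (Z W : finType) (s : Z -> {mpoly F[#|W|]})
    (p : {mpoly F[#|Z|]}) : {mpoly F[#|W|]} :=
  p \mPo [tuple s (enum_val i) | i < #|Z|].

Definition frename (F : fieldType) (Z W : finType) (s : Z -> W) :
    {mpoly F[#|Z|]} -> {mpoly F[#|W|]} :=
  fsubst (fun z => fvar F (s z)).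

(** Algebraic circuits *)

Inductive label (F Z : Type) : Type :=
  | LVar of Z
  | LConst of F
  | LAdd
  | LMul.
Arguments LVar {F Z}.
Arguments LConst {F Z}.
Arguments LAdd {F Z}.
Arguments LMul {F Z}.

Definition is_input (F Z : Type) (l : label F Z) : bool :=
  match l with LVar _ | LConst _ => true | LAdd | LMul => false end.

Definition label_map (F Z : Type) (s : Z -> Z) (l : label F Z) : label F Z :=
  if l is LVar z then LVar (s z) else l.

(* [wire g h] means that the value of g is fed into h; distinct gates may
   carry the same input label. *)
Record circuit (F : Type) (Z : Type) : Type := Circuit {
  gate : finType;
  wire : rel gate;
  glabel : gate -> label F Z;
  output : gate;
  wire_acyclic : forall g h, wire g h -> ~~ connect wire h g;
  wire_connected : forall g h,
    connect (fun x y => wire x y || wire y x) g h;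
  glabel_input : forall g, is_input (glabel g) = ~~ [exists h, wire h g];
  output_unique : forall g, (g == output) = ~~ [exists h, wire g h]
}.
Arguments wire {F Z} c.
Arguments glabel {F Z} c.
Arguments output {F Z} c.

(* Recursion on fuel [k]; by acyclicity the value is stable as soon as k is at
   least the number of gates, see [gate_polyE]. *)
Fixpoint gate_val (F : fieldType) (Z : finType) (C : circuit F Z) (k : nat)
    (g : gate C) : {mpoly F[#|Z|]} :=
  if k is k'.+1 then
    match glabel C g with
    | LVar z => fvar F z
    | LConst c => c%:MP
    | LAdd => \sum_(h | wire C h g) gate_val k' h
    | LMul => \prod_(h | wire C h g) gate_val k' h
    end
  else 0.

Definition gate_poly (F : fieldType) (Z : finType) (C : circuit F Z)
    (g : gate C) : {mpoly F[#|Z|]} := gate_val #|gate C| g.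

Definition circuit_poly (F : fieldType) (Z : finType) (C : circuit F Z) :
    {mpoly F[#|Z|]} := gate_poly (output C).

Lemma gate_val_stable (F : fieldType) (Z : finType) (C : circuit F Z)
    (k l : nat) (g : gate C) :
  (#|[set h | connect (wire C) h g]| <= k)%N ->
  (#|[set h | connect (wire C) h g]| <= l)%N ->
  gate_val k g = gate_val l g.
Proof.
have pos x : (0 < #|[set h | connect (wire C) h x]|)%N.
  by apply/card_gt0P; exists x; rewrite inE connect0.
have lt h x : wire C h x ->
    (#|[set y | connect (wire C) y h]| < #|[set y | connect (wire C) y x]|)%N.
  move=> hx; apply: proper_card; apply/properP; split.
    apply/subsetP=> y; rewrite !inE => yh.
    exact: connect_trans yh (connect1 hx).
  exists x; rewrite inE ?connect0 //; exact: wire_acyclic hx.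
elim: k l g => [|k IH] [|l] g hk hl //.
- by move: (leq_trans (pos g) hk).
- by move: (leq_trans (pos g) hl).
have step h : wire C h g -> gate_val k h = gate_val l h.
  move=> hg; apply: IH; rewrite -ltnS; apply: leq_trans (lt _ _ hg) _ => //.
by rewrite /=; case: (glabel C g) => //; apply: eq_bigr => h /step.
Qed.

Lemma gate_polyE (F : fieldType) (Z : finType) (C : circuit F Z) (g : gate C) :
  gate_poly g =
    match glabel C g with
    | LVar z => fvar F z
    | LConst c => c%:MP
    | LAdd => \sum_(h | wire C h g) gate_poly h
    | LMul => \prod_(h | wire C h g) gate_poly h
    end.
Proof.
rewrite /gate_poly; transitivity (gate_val #|gate C|.+1 g) => //.
apply: gate_val_stable; first exact: max_card.
exact: leq_trans (max_card _) (leqnSn _).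
Qed.

Definition symmetric_circuit (F Z : Type) (A : finType) (Gam : {set A})
    (act : A -> Z -> Z) (C : circuit F Z) : Prop :=
  forall a, a \in Gam -> exists s : {perm gate C},
    (forall g h, wire C (s g) (s h) = wire C g h) /\
    (forall g, glabel C (s g) = label_map (act a) (glabel C g)).

(** The Ideal Proof System, for a system f of polynomials in the variables X,
    indexed by Y; the index y also serves as the fresh variable attached to
    the polynomial f y. *)

Section IPS.
Variables (F : fieldType) (X Y : finType) (f : Y -> {mpoly F[#|X|]}).

Definition ips_certificate (p : {mpoly F[#|{: X + Y}|]}) : Prop :=
  fsubst (fun z : X + Y => match z with inl x => fvar F x | inr _ => 0 end) p
    = 0 /\
  fsubst (fun z : X + Y => match z with inl x => fvar F x | inr y => f y end) p
    = 1.

Definition y_linear (p : {mpoly F[#|{: X + Y}|]}) : Prop :=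
  exists g : Y -> {mpoly F[#|X|]},
    p = \sum_y fvar F (inr y : X + Y) * frename (fun x => inl x : X + Y) (g y).

Definition ips_refutation (C : circuit F (X + Y)) : Prop :=
  ips_certificate (circuit_poly C).

Definition ips_size (C : circuit F (X + Y)) : nat :=
  maxn #|gate C| (#|X| + #|Y|)%N.

(* An invariant system has, for each y, some y' with f y' = s (f y), unique
   when f is injective; the default value y is then irrelevant. *)
Definition ips_act (s : X -> X) (z : X + Y) : X + Y :=
  match z with
  | inl x => inl (s x)
  | inr y => inr (odflt y [pick y' | f y' == frename s (f y)])
  end.

Definition ips_symmetric (A : finType) (Gam : {set A}) (act : A -> X -> X)
    (C : circuit F (X + Y)) : Prop :=
  symmetric_circuit Gam (fun a => ips_act (act a)) C.

End IPS.

(** Finite simple graphs *)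

Record sgraph : Type := SGraph {
  vertex :> finType;
  adj : rel vertex;
  adj_sym : ssrbool.symmetric adj;
  adj_irrefl : irreflexive adj
}.

Definition regular (d : nat) (G : sgraph) : Prop :=
  forall v : G, #|[set w | adj v w]| = d.

Definition connected_graph (G : sgraph) : Prop :=
  forall v w : G, connect (@adj G) v w.

Definition edge_set (G : sgraph) : {set {set G}} :=
  [set e : {set G} | [exists v, [exists w, adj v w && (e == [set v; w])]]].

Definition edge (G : sgraph) : finType := {e : {set G} | e \in edge_set G}.

Definition edge_at (G : sgraph) (v : G) : finType :=
  {e : edge G | v \in val e}.

(** CFI equations *)

Definition cfi_var (G : sgraph) : finType := (edge G * 'F_2)%type.

(* One equation for each vertex v and each choice of an index in F_2 for every
   edge at v, one for each edge, one for each variable; distinct indices give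
   distinct polynomials, see [cfi_inj]. *)
Definition cfi_index (G : sgraph) : finType :=
  ({v : G & {ffun edge_at v -> 'F_2}} + edge G + cfi_var G)%type.

Definition cfi_x (G : sgraph) (e : edge G) (i : 'F_2) :
    {mpoly 'F_2[#|cfi_var G|]} := fvar _ ((e, i) : cfi_var G).

Definition cfi (G : sgraph) (u : G) (a : 'F_2) (j : cfi_index G) :
    {mpoly 'F_2[#|cfi_var G|]} :=
  match j with
  | inl (inl (existT v c)) =>
      \sum_(e : edge_at v) cfi_x (val e) (c e)
        - (\sum_(e : edge_at v) c e + (if v == u then a else 0))%:MP
  | inl (inr e) => cfi_x e 0 + cfi_x e 1 - 1
  | inr x => cfi_x x.1 x.2 ^+ 2 - cfi_x x.1 x.2
  end.

Definition cfi_size (G : sgraph) : nat :=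
  (#|cfi_index G| + #|cfi_var G|)%N.

Definition edge_flips (G : sgraph) : {set {ffun edge G -> 'F_2}} :=
  [set p : {ffun edge G -> 'F_2} |
    [forall v : G, \sum_(e : edge G | v \in val e) p e == 0]].

Definition flip_act (G : sgraph) (p : {ffun edge G -> 'F_2}) (x : cfi_var G) :
    cfi_var G := (x.1, x.2 + p x.1).

Lemma fsubst_fvar (F : fieldType) (Z W : finType) (s : Z -> {mpoly F[#|W|]})
    (z : Z) : fsubst s (fvar F z) = s z.
Proof.
by rewrite /fsubst /fvar comp_mpolyXU -tnth_nth tnth_mktuple enum_rankK.
Qed.

Lemma F2_cases (i : 'F_2) : i = 0 \/ i = 1.
Proof. by case: i => [[|[|i]] // hi]; [left | right]; apply: val_inj. Qed.

Lemma cfi_invariant (G : sgraph) (u : G) (a : 'F_2)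
    (p : {ffun edge G -> 'F_2}) (j : cfi_index G) :
  p \in edge_flips G ->
  exists j', cfi u a j' = frename (@flip_act G p) (cfi u a j).
Proof.
rewrite inE => /forallP pG.
rewrite /frename /fsubst.
set L := [tuple _ | i < _].
have fx e i : cfi_x e i \mPo L = cfi_x e (i + p e).
  exact: (fsubst_fvar (fun x => fvar _ (flip_act p x))).
case: j => [[[v c]|e]|[e i]] /=.
- exists (inl (inl (existT _ v [ffun e => c e + p (val e)]))) => /=.
  rewrite raddfB raddf_sum /= comp_mpolyC; congr (_ - _).
    by apply: eq_bigr => e _; rewrite fx ffunE.
  congr ((_ + _)%:MP); under eq_bigr do rewrite ffunE.
  rewrite big_split /= -[RHS]addr0; congr (_ + _).
  rewrite -[RHS](eqP (pG v)).
  rewrite [RHS](reindex_omap (val : edge_at v -> edge G) insub) /=; last first.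
    by move=> e ve; case: insubP => [f _ <-|] //; rewrite ve.
  by apply: eq_bigl => e; rewrite (valP e) valK eqxx.
- exists (inl (inr e)) => /=.
  rewrite raddfB raddfD /= rmorph1 !fx; congr (_ - _).
  have [->|->] := F2_cases (p e); rewrite ?addr0 // add0r addrC.
  by congr (_ + _); congr cfi_x; apply: val_inj.
- exists (inr (e, i + p e)) => /=.
  by rewrite raddfB /= rmorphXn /= !fx.
Qed.

Section CfiInj.
Variables (G : sgraph) (u : G) (a : 'F_2).

Let mx (x : cfi_var G) : 'X_{1.. #|cfi_var G|} := U_(enum_rank x)%MM.

Let mx_neq0 x : (mx x == 0%MM) = false.
Proof. by rewrite -mdeg_eq0 mdeg1. Qed.

Let mx2_neq0 x : ((mx x *+ 2)%MM == 0%MM) = false.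
Proof. by rewrite -mdeg_eq0 mdegMn mdeg1. Qed.

Let mx_mx2 x y : (mx x == (mx y *+ 2)%MM) = false.
Proof. by apply/eqP => /(congr1 mdeg); rewrite mdegMn !mdeg1. Qed.

Let coef1_x e i x : (cfi_x e i)@_(mx x) = ((e, i) == x)%:R.
Proof. by rewrite mcoeffXU (inj_eq enum_rank_inj). Qed.

Let coef2_x e i x : (cfi_x e i)@_(mx x *+ 2)%MM = 0.
Proof. by rewrite mcoeffX mx_mx2. Qed.

Let coef1_vertex v (c : {ffun edge_at v -> 'F_2}) x :
  (cfi u a (inl (inl (existT _ v c))))@_(mx x) =
    [exists e, (val e, c e) == x]%:R.
Proof.
rewrite /= mcoeffB mcoeffC mx_neq0 mulr0 subr0 raddf_sum /=.
under eq_bigr do rewrite coef1_x.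
case: existsP => [[e /eqP <-]|nx]; last first.
  by rewrite big1 // => e _; case: eqP => // ex; case: nx; exists e; apply/eqP.
rewrite (bigD1 e) //= eqxx big1 ?addr0 // => f fe.
by case: eqP => // -[/val_inj ef _]; rewrite ef eqxx in fe.
Qed.

Let coef1_edge e x : (cfi u a (inl (inr e)))@_(mx x) = (e == x.1)%:R.
Proof.
rewrite /= mcoeffB mcoeffD !coef1_x mcoeff1 mx_neq0 subr0.
case: x => f i; rewrite !xpair_eqE /=.
case: (e == f) => //=; last by rewrite addr0.
by have [->|->] := F2_cases i; rewrite ?eqxx //= ?addr0 ?add0r.
Qed.

Let coef2_lin j x : (cfi u a (inl j))@_(mx x *+ 2)%MM = 0.
Proof.
case: j => [[v c]|e] /=; rewrite mcoeffB.
  rewrite mcoeffC mx2_neq0 mulr0 subr0 raddf_sum big1 // => e _.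
  exact: (coef2_x (val e) (c e) x).
by rewrite mcoeffD !coef2_x mcoeff1 mx2_neq0 subr0 addr0.
Qed.

Let coef2_var y x : (cfi u a (inr y))@_(mx x *+ 2)%MM = (y == x)%:R.
Proof.
rewrite /= mcoeffB coef2_x subr0 mcoeffXn; congr (_%:R); congr nat_of_bool.
case: y => e i /=; apply/eqP/eqP => [|->] //= /mnmP /(_ (enum_rank x)).
rewrite !mulmnE !mnm1E eqxx (inj_eq enum_rank_inj); by case: eqP.
Qed.

Lemma cfi_inj : regular 3 G -> injective (cfi u a).
Proof.
move=> G3.
case=> [j|y] [k|z] jk; last first.
- move/(congr1 (mcoeff (mx y *+ 2)%MM)): jk.
  by rewrite !coef2_var eqxx; case: eqP => [->|_ /eqP].
- move/(congr1 (mcoeff (mx y *+ 2)%MM)): jk.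
  by rewrite coef2_var coef2_lin eqxx => /eqP.
- move/(congr1 (mcoeff (mx z *+ 2)%MM)): jk.
  by rewrite coef2_var coef2_lin eqxx => /eqP.
have lin x : (cfi u a (inl j))@_(mx x) = (cfi u a (inl k))@_(mx x) by rewrite jk.
have ve v c e : (forall x, (cfi u a (inl (inl (existT _ v c))))@_(mx x) =
    (cfi u a (inl (inr e)))@_(mx x)) -> False.
  move=> H; have := H (e, 0); have := H (e, 1).
  rewrite !coef1_vertex !coef1_edge eqxx.
  case: existsP => [[f /eqP[fe cf]] _|_ /eqP //].
  case: existsP => [[g /eqP[ge cg]] _|_ /eqP //].
  have fg : f = g by apply: val_inj; exact: etrans fe (esym ge).
  by move: cf; rewrite fg cg.
case: j k {jk} lin => [[v c]|e] [[w d]|f] lin; first last.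
- have := lin (e, 0); rewrite !coef1_edge eqxx /=.
  by case: eqP => [->|_ /eqP].
- by case: (ve w d e) => x; rewrite lin.
- by case: (ve v c f).
have vw (e : edge_at v) : exists f : edge_at w, val f = val e /\ d f = c e.
  have := lin (val e, c e); rewrite !coef1_vertex.
  have -> : [exists e0, (val e0, c e0) == (val e, c e)].
    by apply/existsP; exists e.
  by case: existsP => [[f /eqP[fe df]] _|_ /eqP //]; exists f.
have evw : v = w.
  apply/eqP/negPn/negP => nvw.
  have nbr x : adj v x -> x = w.
    move=> vx; have hE : [set v; x] \in edge_set G.
      rewrite inE; apply/existsP; exists v; apply/existsP; exists x.
      by rewrite vx eqxx.
    have hv : v \in val (exist (fun e => e \in edge_set G) _ hE : edge G).
      by rewrite /= !inE eqxx.
    have [f [fe _]] := vw (exist (fun e : edge G => v \in val e) _ hv).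
    have := valP f; rewrite [X in val X]fe /= !inE eq_sym (negbTE nvw) /=.
    by move/eqP.
  have : (#|[set x | adj v x]| <= #|[set w]|)%N.
    by apply/subset_leq_card/subsetP => x; rewrite !inE => /nbr ->.
  by rewrite G3 cards1.
case: w / evw d lin vw => d lin vw.
congr (inl (inl (existT _ v _))); apply/ffunP => e.
by have [f [/val_inj -> ->]] := vw e.
Qed.

End CfiInj.

(* Main.v *)
Require Import Defs.
From HB Require Import structures.
From mathcomp Require Import all_boot all_order all_algebra all_fingroup.
From mathcomp Require Import mpoly ring zify.

Set Implicit Arguments.
Unset Strict Implicit.
Unset Printing Implicit Defensive.

Import GRing.Theory.
Local Open Scope ring_scope.

(** For the vertex equations, f_(v,c) = F_v + sum_(e at v) c_e f_e over F_2, with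
    F_v = f_(v,0) and f_e the equation of the edge e; moreover sum_v F_v = 1,
    since every edge has two ends. Edge flips fix every f_e, so the edges may be
    enumerated as e_0, ..., e_(m-1), and
      A_0(t) = t,   A_(i+1)(t) = A_i(t) (A_i(t) + A_i(f_(e_i)))
    defines an additive polynomial A = A_m with small circuits that vanishes at
    every f_e. Hence A(f_(v,c)) = A(F_v) does not depend on c, and the invariant
    product of these 8 values is A(F_v)^8, which is again additive in F_v. So
      1 + sum_v prod_c A(y_(v,c) + [v = u])
    is a symmetric certificate: at y = f it is 1 + A(sum_v F_v + 1)^8 = 1, and at
    y = 0, where A(t) = t^(2^m), it is 1 + 1 = 0. *)

(** * Reindexing big operators along an injection *)

Lemma big_reindex_inj (R : Type) (idx : R) (op : Monoid.com_law idx)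
    (I J : finType) (k : I -> J) (P : pred J) (Q : pred I) (F : J -> R) :
    injective k -> (forall i, P (k i) = Q i) ->
    (forall j, P j -> exists i, j = k i) ->
  \big[op/idx]_(j | P j) F j = \big[op/idx]_(i | Q i) F (k i).
Proof.
move=> k_inj PQ kP.
rewrite (reindex_omap k (fun j => [pick i | k i == j])) /=.
  apply: eq_bigl => i; rewrite PQ; case: pickP => [i' /eqP/k_inj ->|/(_ i)].
    by rewrite eqxx andbT.
  by rewrite eqxx.
move=> j /kP[i ->]; case: pickP => [i' /eqP /= -> //|/(_ i)].
by rewrite eqxx.
Qed.

(** * Circuits cut out of a ranked gate graph *)

Section Prune.
Variables (F : fieldType) (Z T : finType) (w : rel T) (lab : T -> label F Z).
Variables (out : T) (rank : T -> nat).
Hypothesis rank_lt : forall g h, w g h -> (rank g < rank h)%N.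
Hypothesis lab_input : forall g, is_input (lab g) = ~~ [exists h, w h g].

Lemma connect_rank (g h : T) : connect w g h -> (rank g <= rank h)%N.
Proof.
case/connectP => p; elim: p g => [|x p IH] g /= => [_ -> //|/andP[gx xp] hp].
exact: leq_trans (ltnW (rank_lt gx)) (IH _ xp hp).
Qed.

(** A circuit must be connected with a single sink, while a uniformly described set of gates leaves
    dead ends, such as the sum gates of the last layer below. Keeping the gates with a path to [out]
    repairs both and loses no predecessor of a kept gate. *)
Definition pruned : finType := {g : T | connect w g out}.

Definition pruned_wire : rel pruned := fun g h => w (val g) (val h).

Lemma pruned_connect_rank (g h : pruned) :
  connect pruned_wire g h -> (rank (val g) <= rank (val h))%N.
Proof.
case/connectP => p; elim: p g => [|x p IH] g /= => [_ -> //|/andP[gx xp] hp].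
exact: leq_trans (ltnW (rank_lt gx)) (IH _ xp hp).
Qed.

Lemma pruned_acyclic (g h : pruned) :
  pruned_wire g h -> ~~ connect pruned_wire h g.
Proof.
move=> /rank_lt gh; apply/negP => /pruned_connect_rank.
by rewrite leqNgt gh.
Qed.

Definition pruned_out : pruned := exist _ out (connect0 w out).

Lemma connect_pruned_out (g : pruned) : connect pruned_wire g pruned_out.
Proof.
case: g => g gP; case/connectP: (gP) => p; elim: p g gP => [|x p IH] g gP /=.
  move=> _ E; rewrite (_ : exist _ g gP = pruned_out) ?connect0 //.
  exact: val_inj.
move=> /andP[gx xp] E.
have xP : connect w x out by apply/connectP; exists p.
apply: connect_trans (connect1 _) (IH _ xP xp E).
exact: gx.
Qed.

Lemma pruned_connected (g h : pruned) :
  connect (fun x y => pruned_wire x y || pruned_wire y x) g h.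
Proof.
pose e x y := pruned_wire x y || pruned_wire y x.
have to_out x : connect e x pruned_out.
  by apply: connect_sub (connect_pruned_out x) => a b ab; rewrite connect1 /e ?ab.
have e_sym : connect_sym e.
  by apply: sym_connect_sym => x y; rewrite /e orbC.
by apply: connect_trans (to_out g) _; rewrite -/e e_sym.
Qed.

Lemma pruned_input (g : pruned) :
  is_input (lab (val g)) = ~~ [exists h, pruned_wire h g].
Proof.
rewrite lab_input; congr (~~ _); apply/existsP/existsP => [[h hg]|[h hg]].
  have hP : connect w h out by apply: connect_trans (connect1 hg) (valP g).
  by exists (exist _ h hP).
by exists (val h).
Qed.

Lemma pruned_output (g : pruned) :
  (g == pruned_out) = ~~ [exists h, pruned_wire g h].
Proof.
apply/eqP/idP => [->|].
  apply/existsP => -[h /rank_lt /=].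
  by rewrite ltnNge (connect_rank (valP h)).
case/connectP: (connect_pruned_out g) => -[|h p] /= => [_ -> //|].
by move=> /andP[gh _] _ /negP[]; apply/existsP; exists h.
Qed.

Definition prune : circuit F Z :=
  @Circuit F Z pruned pruned_wire (fun g => lab (val g)) pruned_out
    pruned_acyclic pruned_connected pruned_input pruned_output.

Lemma card_prune : (#|gate prune| <= #|T|)%N.
Proof. by rewrite /= card_sig max_card. Qed.

(** The gate equations have a unique solution, by induction on [rank]; they survive pruning because
    all predecessors of a kept gate are kept. *)
Lemma prune_poly (v : T -> {mpoly F[#|Z|]}) :
    (forall g, v g = match lab g with
      | LVar z => fvar F z
      | LConst c => c%:MP
      | LAdd => \sum_(h | w h g) v h
      | LMul => \prod_(h | w h g) v h
      end) ->
  circuit_poly prune = v out.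
Proof.
move=> vE.
suff H n (g : gate prune) : (rank (val g) < n)%N -> gate_poly g = v (val g).
  exact: (H _ (output prune) (ltnSn _)).
elim: n g => // n IH g; rewrite ltnS => gn.
have step (h : gate prune) : wire prune h g -> gate_poly h = v (val h).
  by move=> hg; apply: IH; apply: leq_trans (rank_lt hg) gn.
have sub h : w h (val g) -> exists i : gate prune, h = val i.
  move=> hg; have hP : connect w h out.
    exact: connect_trans (connect1 hg) (valP g).
  by exists (exist _ h hP).
rewrite gate_polyE vE /=; case: (lab (val g)) => //.
  rewrite (big_reindex_inj _ _ val_inj (fun _ => erefl) sub).
  exact: eq_bigr.
rewrite (big_reindex_inj _ _ val_inj (fun _ => erefl) sub).
exact: eq_bigr.
Qed.

(** A map that preserves wires and fixes [out] carries paths to [out] to such paths, so it restricts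
    to the kept gates; injectivity makes it a permutation there. *)
Lemma prune_symmetric (A : finType) (Gam : {set A}) (act : A -> Z -> Z) :
    (forall a, a \in Gam -> exists s : T -> T,
      [/\ injective s, s out = out, forall g h, w (s g) (s h) = w g h
        & forall g, lab (s g) = label_map (act a) (lab g)]) ->
  symmetric_circuit Gam act prune.
Proof.
move=> sym a /sym[s [s_inj s_out s_w s_lab]].
have sP (g : pruned) : connect w (s (val g)) out.
  case: g => g /= /connectP[p]; elim: p g => [|x p IH] g /=.
    by move=> _ <-; rewrite s_out connect0.
  move=> /andP[gx xp] E; apply: connect_trans (IH _ xp E).
  by rewrite connect1 // s_w.
pose t (g : pruned) : pruned := exist _ (s (val g)) (sP g).
have t_inj : injective t by move=> g h [/s_inj/val_inj].
exists (perm t_inj); split => [g h|g]; rewrite !permE /=; last exact: s_lab.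
exact: s_w.
Qed.

End Prune.

(** * Additive polynomials with prescribed roots in characteristic 2 *)

Section Annihilator.
Variables (R : comNzRingType) (charR : 2 \in [pchar R]) (f : nat -> R).

(* The additive polynomial whose roots are the sums of subfamilies of
   f 0, ..., f (i - 1). *)
Fixpoint annih (i : nat) (t : R) : R :=
  if i is j.+1 then annih j t * (annih j t + annih j (f j)) else t.

(** Expanding the product leaves the cross term [a * b] twice, which is zero in characteristic 2. *)
Lemma annihD (i : nat) (s t : R) : annih i (s + t) = annih i s + annih i t.
Proof.
elim: i s t => //= i IH s t; rewrite IH.
set a := annih i s; set b := annih i t; set c := annih i (f i).
rewrite (_ : _ * _ = a * (a + c) + b * (b + c) + (a * b + a * b)); last by ring.
by rewrite addrr_pchar2 // addr0.
Qed.

Lemma annih0 (i : nat) : annih i 0 = 0.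
Proof. by elim: i => //= i ->; rewrite mul0r. Qed.

Lemma annih_sum (I : Type) (r : seq I) (P : pred I) (i : nat) (F : I -> R) :
  annih i (\sum_(k <- r | P k) F k) = \sum_(k <- r | P k) annih i (F k).
Proof. exact: (big_morph _ (annihD i) (annih0 i)). Qed.

(** Step [j.+1] has a factor that doubles at [f j], hence vanishes; later steps keep the root. *)
Lemma annih_root (i j : nat) : (j < i)%N -> annih i (f j) = 0.
Proof.
elim: i => //= i IH; rewrite ltnS leq_eqVlt => /predU1P[->|/IH ->].
  by rewrite addrr_pchar2 ?mulr0.
by rewrite mul0r.
Qed.

(** With every [f j] zero, each step is squaring. *)
Lemma annih1 (i : nat) : (forall j, f j = 0) -> annih i 1 = 1.
Proof. by move=> f0; elim: i => //= i ->; rewrite f0 annih0 addr0 mulr1. Qed.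

End Annihilator.

(** * The annihilator computed on all entries in parallel *)

Section Layers.
Variables (D E : finType).

Definition pivot (i : nat) (s : D + E) : bool :=
  if s is inr e then enum_rank e == i :> nat else false.

(** The sum ranges over a set of entries, as wires do. When [s] is itself the pivot it has a single
    summand, and the step squares instead of annihilating; [unpivoted] excludes this case. *)
Fixpoint layer (R : comNzRingType) (src : D + E -> R) (i : nat) (s : D + E) : R :=
  if i is j.+1 then
    layer src j s * \sum_(t | (t == s) || pivot j t) layer src j t
  else src s.

Lemma rmorph_layer (R S : comNzRingType) (phi : {rmorphism R -> S})
    (src : D + E -> R) (i : nat) (s : D + E) :
  phi (layer src i s) = layer (phi \o src) i s.
Proof.
elim: i s => //= i IH s; rewrite rmorphM rmorph_sum IH; congr (_ * _).
exact: eq_bigr.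
Qed.

Lemma eq_layer (R : comNzRingType) (src src' : D + E -> R) (i : nat) (s : D + E) :
  src =1 src' -> layer src i s = layer src' i s.
Proof.
move=> eq_src; elim: i s => //= i IH s; rewrite IH; congr (_ * _).
exact: eq_bigr.
Qed.

(** At most one summand, with default 0 once [i] exceeds all ranks in [E]. *)
Definition pivot_value (R : comNzRingType) (src : D + E -> R) (i : nat) : R :=
  \sum_(e : E | enum_rank e == i :> nat) src (inr e).

Lemma pivot_value_rank (R : comNzRingType) (src : D + E -> R) (e : E) :
  pivot_value src (enum_rank e) = src (inr e).
Proof.
rewrite /pivot_value (big_pred1 e) // => e'.
by rewrite /= (inj_eq val_inj) (inj_eq enum_rank_inj).
Qed.

Definition unpivoted (i : nat) (s : D + E) : bool :=
  if s is inr e then (i <= enum_rank e)%N else true.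

(** An entry that has not yet served as pivot differs from the current one, so the sum in [layer]
    splits into the two terms that [annih] adds. *)
Lemma layerE (R : comNzRingType) (src : D + E -> R) (i : nat) (s : D + E) :
  unpivoted i s -> layer src i s = annih (pivot_value src) i (src s).
Proof.
elim: i s => //= i IH s si.
have si' : unpivoted i s by move: si; case: (s) => // e /ltnW.
have npivot : ~~ pivot i s by move: si; case: (s) => //= e; case: ltngtP.
rewrite IH //; congr (_ * _).
rewrite (bigD1 s) ?eqxx //= IH //; congr (_ + _).
rewrite (@big_reindex_inj _ _ _ _ _ (@inr D E) _ (fun e => enum_rank e == i :> nat)).
(* The entry of rank [i] is still unpivoted at step [i], so the induction hypothesis covers it; if
   no such entry exists, both sums are empty. *)
- case: (ltnP i #|E|) => [iE|Ei].
    have ranki (e : E) : (enum_rank e == i :> nat) = (e == enum_val (Ordinal iE)).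
      by rewrite -(inj_eq enum_rank_inj) enum_valK.
    rewrite /pivot_value !(big_pred1 (enum_val (Ordinal iE))) // IH //.
    by rewrite /= enum_valK.
  have none (e : E) : (enum_rank e == i :> nat) = false.
    by apply/eqP => ei; have := ltn_ord (enum_rank e); rewrite ei ltnNge Ei.
  by rewrite /pivot_value !big_pred0 // annih0.
- by move=> a b [].
- move=> e /=; case: eqP => [es|_] /=; last by rewrite andbT.
  by move: npivot; rewrite -es /= => /negbTE ->.
- by case=> [d|e] /andP[]; [rewrite orbF => -> | exists e].
Qed.

End Layers.

(** * The layered circuit, its polynomial and its automorphisms *)

Section LayeredCircuit.
Variables (F : fieldType) (Z D E V : finType).
Variables (vert : D -> V) (u : V) (var : D + E -> Z).
Hypothesis vert_surj : forall v, exists d, vert d = v.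

Definition raw_gate : finType :=
  ((D + E) + ('I_#|E|.+1 * (D + E) * bool) + (V + bool))%type.

Notation Inp s := (inl (inl s)).
Notation Lay i s b := (inl (inr (i, s, b))).
Notation Prod v := (inr (inl v)).
Notation One := (inr (inr false)).
Notation Out := (inr (inr true)).

Definition at_vertex (v : V) (s : D + E) : bool :=
  if s is inl d then vert d == v else false.

(* The gate (i, s, false) computes [layer i s], and (i, s, true) the sum that
   it is multiplied with to obtain [layer i.+1 s]. *)
Definition raw_wire (g h : raw_gate) : bool :=
  match g, h with
  | Inp s, Lay i t b => [&& i == 0%N :> nat, ~~ b & s == t]
  | One, Lay i t b => [&& i == 0%N :> nat, ~~ b & at_vertex u t]
  | Lay i s b, Lay j t c =>
      if c then [&& ~~ b, i == j & (s == t) || pivot i s]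
      else (j == i.+1 :> nat) && (s == t)
  | Lay i s b, Prod v => [&& i == #|E| :> nat, ~~ b & at_vertex v s]
  | Prod _, Out | One, Out => true
  | _, _ => false
  end.

Definition raw_label (g : raw_gate) : label F Z :=
  match g with
  | Inp s => LVar (var s)
  | Lay i _ b => if b || (i == 0%N :> nat) then LAdd else LMul
  | Prod _ => LMul
  | inr (inr b) => if b then LAdd else LConst 1
  end.

(** Doubling the layer index leaves room for the sum gates between consecutive layers. *)
Definition raw_rank (g : raw_gate) : nat :=
  match g with
  | Inp _ => 0
  | Lay i _ b => (i.*2 + b).+1
  | Prod _ => (#|E|.*2).+3
  | inr (inr b) => if b then (#|E|.*2).+4 else 0
  end.

Lemma raw_rank_lt (g h : raw_gate) : raw_wire g h -> (raw_rank g < raw_rank h)%N.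
Proof.
case: g => [[s|[[i s] b]]|[v|[]]]; case: h => [[t|[[j t] c]]|[v'|[]]] //=.
- case: c; first by case/and3P=> /negbTE -> /eqP <- _; rewrite addn0 addn1.
  by case/andP=> /eqP -> _; rewrite doubleS addn0 !ltnS; case: b; rewrite ?addn1 ?addn0 ?leqnSn.
- by case/and3P=> _ /negbTE -> _; rewrite addn0 !ltnS ltnW // ltnS leq_double -ltnS.
Qed.

Lemma raw_label_input (g : raw_gate) :
  is_input (raw_label g) = ~~ [exists h, raw_wire h g].
Proof.
case: g => [[s|[[i s] b]]|[v|[]]] /=.
- by apply/esym/existsP => -[h]; case: h => [[t|[[j t] c]]|[v'|[]]].
- have -> : is_input (if b || (i == 0%N :> nat) then LAdd else LMul : label F Z) = false.
    by case: ifP.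
  apply/esym/negbTE; rewrite negbK; apply/existsP; case: b.
    by exists (Lay i s false); rewrite /= !eqxx.
  case: i => [[|i] i_lt] /=; first by exists (Inp s) => /=.
  by exists (Lay (Ordinal (ltnW i_lt)) s false); rewrite /= !eqxx.
- apply/esym/negbTE; rewrite negbK; apply/existsP; have [d dv] := vert_surj v.
  by exists (Lay ord_max (inl d) false); rewrite /= dv !eqxx.
- by apply/esym/negbTE; rewrite negbK; apply/existsP; exists One.
- by apply/esym/existsP => -[h]; case: h => [[t|[[j t] c]]|[v'|[]]].
Qed.

Definition layered_circuit : circuit F Z :=
  prune (Out : raw_gate) raw_rank_lt raw_label_input.

Lemma card_layered_circuit :
  (#|gate layered_circuit| <=
     #|{: D + E}| + #|E|.+1 * #|{: D + E}| * 2 + (#|V| + 2))%N.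
Proof.
apply: leq_trans (card_prune _ _ _) _.
by rewrite /raw_gate !(card_sum, card_prod) card_ord card_bool.
Qed.

(** The shift at [u] cancels the constant 1 of the equations at [u] when y = f, and supplies the
    only nonzero entries when y = 0. *)
Definition layered_src (s : D + E) : {mpoly F[#|Z|]} :=
  fvar F (var s) + (at_vertex u s)%:R.

Definition raw_value (g : raw_gate) : {mpoly F[#|Z|]} :=
  match g with
  | Inp s => fvar F (var s)
  | Lay i s b => if b then \sum_(t | (t == s) || pivot i t) layer layered_src i t
                 else layer layered_src i s
  | Prod v => \prod_(d | vert d == v) layer layered_src #|E| (inl d)
  | inr (inr b) =>
      if b then 1 + \sum_v \prod_(d | vert d == v) layer layered_src #|E| (inl d)
      else 1
  end.

Lemma raw_valueE (g : raw_gate) :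
  raw_value g = match raw_label g with
    | LVar z => fvar F z
    | LConst c => c%:MP
    | LAdd => \sum_(h | raw_wire h g) raw_value h
    | LMul => \prod_(h | raw_wire h g) raw_value h
    end.
Proof.
case: g => [[s|[[i s] b]]|[v|[]]] //=.
- case: b => /=.
    rewrite (@big_reindex_inj _ _ _ _ _ (fun t => Lay i t false : raw_gate) _
      (fun t => (t == s) || pivot i t)) //=.
    + by move=> a b [].
    + by move=> t; rewrite eqxx.
    + case=> [[t|[[j t] c]]|[v'|[]]] //=; last by rewrite andbF.
        by rewrite andbF.
      by case/and3P=> /negbTE -> /eqP -> _; exists t.
  case: i => [[|i] i_lt] /=.
    (* The boolean lists the predecessors of a gate of layer 0: its variable and, at [u], the
       constant 1. *)
    rewrite (@big_reindex_inj _ _ _ _ _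
      (fun b : bool => if b then Inp s else One : raw_gate) _
      (fun b => b || at_vertex u s)) /=.
    + by rewrite big_mkcond big_bool /= /layered_src; case: at_vertex.
    + by case=> [] [].
    + by case; rewrite /= ?eqxx.
    + case=> [[t|[[j t] c]]|[v'|[]]] //=; last by exists false.
      by move/eqP->; exists true.
  have i_lt' : (i < #|E|.+1)%N by apply: ltnW.
  (* Here the boolean selects one of the two factors: the previous layer or its sum gate. *)
  rewrite (@big_reindex_inj _ _ _ _ _
    (fun b : bool => Lay (Ordinal i_lt') s b : raw_gate) _ predT) /=.
  + by rewrite big_bool /= mulrC.
  + by move=> a b [].
  + by move=> b; rewrite !eqxx.
  + case=> [[t|[[j t] c]]|[v'|[]]] //=.
    rewrite eqSS => /andP[/eqP ij /eqP ->]; exists c.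
    by congr (Lay _ _ _); apply: val_inj.
- rewrite (@big_reindex_inj _ _ _ _ _ (fun d => Lay ord_max (inl d) false : raw_gate) _
    (fun d => vert d == v)) //=.
  + by move=> a b [].
  + by move=> d; rewrite eqxx.
  + case=> [[t|[[j t] c]]|[v'|[]]] //=.
    case: t => [d|e] /and3P[/eqP jE /negbTE -> //] _; exists d.
    by congr (Lay _ _ _); apply: val_inj.
- rewrite (bigD1 (One : raw_gate)) //=; congr (_ + _).
  rewrite (@big_reindex_inj _ _ _ _ _ (fun v => Prod v : raw_gate) _ predT) //=.
  + by move=> a b [].
  + by case=> [[t|[[j t] c]]|[v'|[]]] //= _; exists v'.
Qed.

Lemma layered_circuit_poly :
  circuit_poly layered_circuit =
    1 + \sum_v \prod_(d | vert d == v) layer layered_src #|E| (inl d).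
Proof. exact: (prune_poly _ _ _ raw_valueE). Qed.

(** The automorphism permutes the entries from [D] within each vertex and layer and fixes those from
    [E]. Pivots therefore stay in place, although they are processed in an arbitrary order. *)
Lemma layered_circuit_symmetric (A : finType) (Gam : {set A}) (act : A -> Z -> Z) :
    (forall a, a \in Gam -> exists t : D -> D,
      [/\ injective t, forall d, vert (t d) = vert d,
          forall d, var (inl (t d)) = act a (var (inl d))
        & forall e, var (inr e) = act a (var (inr e))]) ->
  symmetric_circuit Gam act layered_circuit.
Proof.
move=> sym; apply: prune_symmetric => a /sym[t [t_inj t_vert t_l t_r]].
pose ts (s : D + E) : D + E := if s is inl d then inl (t d) else s.
have ts_inj : injective ts by case=> [d|e] [d'|e'] //= [/t_inj ->].
have ts_vert v s : at_vertex v (ts s) = at_vertex v s.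
  by case: s => //= d; rewrite t_vert.
have ts_pivot i s : pivot i (ts s) = pivot i s by case: s.
pose tg (g : raw_gate) : raw_gate :=
  match g with
  | Inp s => Inp (ts s)
  | Lay i s b => Lay i (ts s) b
  | inr x => inr x
  end.
exists tg; split=> //.
- case=> [[s|[[i s] b]]|x] [[s'|[[i' s'] b']]|x'] //=.
  + by case=> /ts_inj ->.
  + by case=> -> /ts_inj -> ->.
- by case=> [[s|[[i s] b]]|[v|[]]] [[s'|[[i' s'] b']]|[v'|[]]] //=;
    rewrite ?(inj_eq ts_inj) ?ts_vert ?ts_pivot.
- by case=> [[[d|e]|[[i s] b]]|[v|[]]] //=; rewrite ?t_l -?t_r //; case: ifP.
Qed.

End LayeredCircuit.

(** * Substitution as a ring morphism, and the action on equations *)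

HB.instance Definition _ (F : fieldType) (Z W : finType)
    (s : Z -> {mpoly F[#|W|]}) :=
  GRing.RMorphism.copy (fsubst s) (comp_mpoly [tuple s (enum_val i) | i < #|Z|]).

Lemma eq_fsubst (F : fieldType) (Z W : finType) (s t : Z -> {mpoly F[#|W|]})
    (p : {mpoly F[#|Z|]}) : s =1 t -> fsubst s p = fsubst t p.
Proof.
by move=> st; rewrite /fsubst (eq_mktuple _ (fun i => st (enum_val i))).
Qed.

Lemma fsubstC (F : fieldType) (Z W : finType) (s : Z -> {mpoly F[#|W|]}) (c : F) :
  fsubst s c%:MP = c%:MP.
Proof. exact: comp_mpolyC. Qed.

Lemma fsubst_comp (F : fieldType) (Z W X : finType) (s : W -> {mpoly F[#|X|]})
    (t : Z -> {mpoly F[#|W|]}) (p : {mpoly F[#|Z|]}) :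
  fsubst s (fsubst t p) = fsubst (fun z => fsubst s (t z)) p.
Proof.
elim/mpolyind: p => [|c m p _ _ IH]; first by rewrite !rmorph0.
rewrite !rmorphD /= IH; congr (_ + _).
rewrite -mul_mpolyC !rmorphM /= !fsubstC; congr (_ * _).
rewrite mpolyXE_id !rmorph_prod /=; apply: eq_bigr => i _.
rewrite !rmorphXn /=; congr (_ ^+ _).
have -> : 'X_i = fvar F (enum_val i) by rewrite /fvar enum_valK.
by rewrite !fsubst_fvar.
Qed.

Lemma mpoly_pchar2 (n : nat) : 2%N \in [pchar {mpoly 'F_2[n]}].
Proof. exact: (rmorph_pchar (@mpolyC n 'F_2)) (pchar_Fp (isT : prime 2)). Qed.

(** Injectivity leaves [y'] as the only index that [pick] can return. *)
Lemma ips_act_inr (F : fieldType) (X Y : finType) (f : Y -> {mpoly F[#|X|]})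
    (s : X -> X) (y y' : Y) :
    injective f -> f y' = frename s (f y) ->
  ips_act f s (inr y) = inr y'.
Proof.
move=> f_inj fy /=; congr inr; case: pickP => [z /eqP|/(_ y')].
  by rewrite -fy => /f_inj.
by rewrite fy eqxx.
Qed.

(** * Incidence counts and the indices of vertex equations *)

Lemma big_edge_at (R : Type) (idx : R) (op : Monoid.com_law idx)
    (G : sgraph) (v : G) (F : edge G -> R) :
  \big[op/idx]_(e : edge_at v) F (val e)
    = \big[op/idx]_(e : edge G | v \in val e) F e.
Proof.
rewrite (@big_reindex_inj _ _ op _ _ (val : edge_at v -> edge G) _ predT) //.
- exact: val_inj.
- by move=> e; rewrite (valP e).
- by move=> e ve; exists (exist _ e ve).
Qed.

Lemma card_edge (G : sgraph) (e : edge G) : #|val e| = 2.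
Proof.
case: e => /= e; rewrite inE => /existsP[v /existsP[w /andP[vw /eqP ->]]].
by rewrite cards2; case: eqP vw => // ->; rewrite adj_irrefl.
Qed.

(** Sending [w] to the edge {v, w} is a bijection from neighbours to incident edges; injectivity
    uses the absence of loops. *)
Lemma card_edge_at (G : sgraph) (v : G) : #|edge_at v| = #|[set w | adj v w]|.
Proof.
rewrite card_sig -(card_imset _ val_inj) /=.
pose k (w : G) := [set v; w].
have k_inj : {in [set w | adj v w] &, injective k}.
  move=> w w'; rewrite !inE => vw vw' /setP/(_ w).
  rewrite !inE eqxx orbT; case: eqP vw => [<-|_ _]; first by rewrite adj_irrefl.
  by move/esym/eqP.
rewrite -(card_in_imset k_inj); apply: eq_card => e.
apply/imsetP/imsetP => [[[e' e'P]]|[w]].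
  rewrite inE /= => ve' ->; move: e'P ve'; rewrite inE.
  case/existsP=> a /existsP[b /andP[ab /eqP ->]]; rewrite !inE.
  case/orP=> /eqP va; first by exists b; rewrite ?inE /k va.
  by exists a; rewrite ?inE /k va 1?adj_sym // setUC.
rewrite inE => vw ->.
have kE : k w \in edge_set G.
  by rewrite inE; apply/existsP; exists v; apply/existsP; exists w; rewrite vw eqxx.
by exists (exist (fun e => e \in edge_set G) _ kE) => //; rewrite inE /= !inE eqxx.
Qed.

Definition vertex_eq (G : sgraph) : finType := {v : G & {ffun edge_at v -> 'F_2}}.

Definition flip_vertex_eq (G : sgraph) (p : {ffun edge G -> 'F_2})
    (d : vertex_eq G) : vertex_eq G :=
  let: existT v c := d in existT _ v [ffun e : edge_at v => c e + p (val e)].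

Lemma big_vertex_eq (R : Type) (idx : R) (op : Monoid.com_law idx)
    (G : sgraph) (v : G) (F : vertex_eq G -> R) :
  \big[op/idx]_(d : vertex_eq G | tag d == v) F d
    = \big[op/idx]_(c : {ffun edge_at v -> 'F_2}) F (existT _ v c).
Proof.
rewrite (@big_reindex_inj _ _ op _ _
  (fun c : {ffun edge_at v -> 'F_2} => existT _ v c : vertex_eq G) _ predT) //.
- by move=> a b /eqP; rewrite -tag_eqE /tag_eq eqxx /= tagged_asE => /eqP.
- by move=> c; rewrite /= eqxx.
- by case=> w c /= /eqP wv; case: _ / wv; exists c.
Qed.

(** * Evaluating the certificate under a substitution *)

Section CfiCertificate.
Variables (G : sgraph) (R : comNzRingType) (charR : 2%N \in [pchar R]).
Variables (src : vertex_eq G + edge G -> R).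

Definition cfi_annih : R -> R := annih (pivot_value src) #|edge G|.

Lemma layer_vertex_eq (d : vertex_eq G) :
  layer src #|edge G| (inl d) = cfi_annih (src (inl d)).
Proof. exact: layerE. Qed.

Lemma cfi_annih_edge (e : edge G) : cfi_annih (src (inr e)) = 0.
Proof. by rewrite -pivot_value_rank; apply: annih_root. Qed.

(** This form covers both substitutions: [Fv v] will be the sum of the x^e_0 at [v] for y = f, and
    [v = u] for y = 0. *)
Variable Fv : G -> R.
Hypothesis src_vertex : forall v (c : {ffun edge_at v -> 'F_2}),
  src (inl (existT _ v c)) =
    Fv v + \sum_(e : edge_at v) (if c e == 0 then 0 else src (inr (val e))).

Lemma cfi_annih_vertex (d : vertex_eq G) :
  cfi_annih (src (inl d)) = cfi_annih (Fv (tag d)).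
Proof.
case: d => v c; rewrite src_vertex /cfi_annih annihD // annih_sum //.
rewrite big1 ?addr0 // => e _; case: eqP => _; first by rewrite annih0.
exact: cfi_annih_edge.
Qed.

(** By 3-regularity a vertex has 2^3 = 8 equations, all with the same annihilated value; as 8 is a
    power of the characteristic, the eighth power is additive. *)
Lemma sum_prod_layer : regular 3 G ->
  \sum_(v : G) \prod_(d : vertex_eq G | tag d == v) layer src #|edge G| (inl d)
    = cfi_annih (\sum_v Fv v) ^+ 8.
Proof.
move=> G3; rewrite /cfi_annih annih_sum //.
have -> (x : G -> R) : (\sum_v x v) ^+ 8 = \sum_v x v ^+ 8.
  apply: (big_morph (fun a => a ^+ 8)); last by rewrite expr0n.
  move=> a b; by rewrite exprDn_pchar // (eq_pnat 8 (pcharf_eq charR)).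
apply: eq_bigr => v _; rewrite big_vertex_eq.
rewrite (eq_bigr (fun=> cfi_annih (Fv v))); last first.
  by move=> c _; rewrite layer_vertex_eq cfi_annih_vertex.
by rewrite prodr_const card_ffun card_ord card_edge_at G3.
Qed.

End CfiCertificate.

(** * The circuit for the CFI equations and its four properties *)

Section CfiRefutation.
Variables (G : sgraph) (G3 : regular 3 G) (u : G).

Let X := cfi_var G.
Let Y := cfi_index G.

Lemma vertex_eq_surj (v : G) : exists d : vertex_eq G, tag d = v.
Proof. by exists (existT _ v [ffun=> 0]). Qed.

Definition cfi_circuit : circuit 'F_2 (X + Y) :=
  @layered_circuit 'F_2 (X + Y)%type (vertex_eq G) (edge G) G tag u
    (fun s => inr (inl s)) vertex_eq_surj.

Lemma fsubst_cfi_circuit (W : finType) (s : X + Y -> {mpoly 'F_2[#|W|]}) :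
  fsubst s (circuit_poly cfi_circuit) =
    1 + \sum_(v : G) \prod_(d : vertex_eq G | tag d == v)
          layer (fun t => s (inr (inl t)) + (at_vertex tag u t)%:R)
            #|edge G| (inl d).
Proof.
rewrite layered_circuit_poly rmorphD rmorph1 rmorph_sum; congr (_ + _).
apply: eq_bigr => v _; rewrite rmorph_prod; apply: eq_bigr => d _.
rewrite rmorph_layer; apply: eq_layer => t /=.
by rewrite /layered_src rmorphD rmorph_nat /= fsubst_fvar.
Qed.

Lemma sum_edge_ends (R : comNzRingType) (F : edge G -> R) :
  2%N \in [pchar R] -> \sum_(v : G) \sum_(e : edge_at v) F (val e) = 0.
Proof.
move=> charR; under eq_bigr do rewrite big_edge_at big_mkcond.
rewrite exchange_big big1 // => e _; rewrite -big_mkcond sumr_const card_edge.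
by rewrite mulr2n addrr_pchar2.
Qed.

Lemma cfi_circuit_refutation : ips_refutation (cfi u 1) cfi_circuit.
Proof.
split; rewrite fsubst_cfi_circuit.
  (* At y = 0 the edge entries vanish, so [cfi_annih] is iterated squaring and sends the total 1 to
     1, cancelling the leading 1. *)
  rewrite (@sum_prod_layer _ _ (mpoly_pchar2 _) _ (fun v => (v == u)%:R)) //.
    rewrite (bigD1 u) //= eqxx big1 ?addr0; last by move=> v /negbTE ->.
    rewrite /cfi_annih annih1 ?expr1n ?addrr_pchar2 ?mpoly_pchar2 // => j.
    by rewrite /pivot_value big1 // => e _; rewrite /= addr0.
  move=> v c; rewrite /= big1 ?addr0 ?add0r // => e _.
  by case: ifP => _; rewrite ?addr0.
have char2 := mpoly_pchar2 #|X|.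
(* At y = f the shift has removed the constant at [u], so the total is a sum of x^e_0 over both ends
   of every edge, which is 0. *)
rewrite (@sum_prod_layer _ _ char2 _
  (fun v => \sum_(e : edge_at v) cfi_x (val e) 0)) //.
  by rewrite (sum_edge_ends (fun e => cfi_x e 0)) // /cfi_annih annih0 expr0n addr0.
move=> v c /=; rewrite -big_split /= rmorphD rmorph_sum /= opprD -!addrA.
rewrite (_ : - _ + (v == u)%:R = 0); last first.
  by case: (v == u); rewrite ?mpolyC1 ?mpolyC0 ?addNr ?oppr0 ?addr0.
rewrite addr0 -sumrN -big_split /=; apply: eq_bigr => e _.
(* For [c e] = 1: x_1 - 1 = x_0 + (x_0 + x_1 - 1), since x_0 + x_0 = 0. *)
have [->|->] := F2_cases (c e); rewrite /= ?eqxx ?mpolyC0 ?subr0 ?addr0 //.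
by rewrite mpolyC1 addrA addrA addrr_pchar2 // add0r.
Qed.

Lemma cfi_circuit_symmetric :
  ips_symmetric (cfi u 1) (edge_flips G) (@flip_act G) cfi_circuit.
Proof.
apply: layered_circuit_symmetric => p; rewrite inE => /forallP pG.
have fx e i : frename (flip_act p) (cfi_x e i) = cfi_x e (i + p e).
  exact: fsubst_fvar.
exists (flip_vertex_eq p); split=> //.
- case=> v c [w c'] /= /eqP; rewrite -tag_eqE /tag_eq /=.
  case: eqP => //= vw; case: _ / vw c' => c'; rewrite tagged_asE => /eqP/ffunP cc'.
  by congr (existT _ _ _); apply/ffunP => e; have := cc' e; rewrite !ffunE => /addIr.
- by case.
- case=> v c; apply/esym/ips_act_inr; first exact: cfi_inj.
  rewrite /= /frename rmorphB rmorph_sum /= fsubstC; congr (_ - _).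
    by apply: eq_bigr => e _; rewrite ffunE [RHS]fx.
  congr ((_ + _)%:MP); under eq_bigr do rewrite ffunE.
  (* The constant term is unchanged because the flips at [v] sum to zero. *)
  by rewrite big_split /= (big_edge_at _ _ p) (eqP (pG v)) addr0.
(* A flip at most swaps the two variables of [e], so the edge equation is fixed. *)
- move=> e; apply/esym/ips_act_inr; first exact: cfi_inj.
  rewrite /= /frename rmorphB rmorphD rmorph1 /= -!/(frename _ _) !fx; congr (_ - _).
  have [->|->] := F2_cases (p e); rewrite ?addr0 // add0r addrC.
  by congr (_ + _); congr cfi_x; apply: val_inj.
Qed.

(** Put x = 0, y = 1 on a set [w] of vertex equations and y = 0 elsewhere. A linear certificate
    would be additive in [w], but the circuit gives 1 for every nonempty [w] at [u]. Two singletons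
    and their union yield 1 = 1 + 1. *)
Lemma cfi_circuit_not_linear : ~ y_linear (circuit_poly cfi_circuit).
Proof.
move=> [g gP].
pose s (w : pred (vertex_eq G)) (z : X + Y) : {mpoly 'F_2[#|X|]} :=
  if z is inr (inl (inl d)) then (w d)%:R else 0.
pose k y := fsubst (fun=> 0) (g y) : {mpoly 'F_2[#|X|]}.
have linE w : fsubst (s w) (circuit_poly cfi_circuit) =
    \sum_(d | w d) k (inl (inl d)).
  rewrite gP rmorph_sum /=.
  rewrite [RHS](_ : _ = \sum_d (w d)%:R * k (inl (inl d))); last first.
    by rewrite big_mkcond; apply: eq_bigr => d _; case: (w d); rewrite ?mul1r ?mul0r.
  rewrite (bigID (fun y => if y is inl (inl _) then true else false)) /=.
  rewrite [X in _ + X]big1 ?addr0; last first.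
    by move=> [[d|e]|x] //= _; rewrite rmorphM /= fsubst_fvar mul0r.
  rewrite (@big_reindex_inj _ _ _ _ _ (fun d => inl (inl d) : Y) _ predT) //=.
  - apply: eq_bigr => d _; rewrite rmorphM /= fsubst_fvar; congr (_ * _).
    rewrite /frename fsubst_comp; apply: eq_fsubst => x.
    exact: fsubst_fvar.
  - by move=> a b [].
  - by move=> [[d|e]|x] //= _; exists d.
have circE (w : pred (vertex_eq G)) d :
    tag d = u -> w d -> {subset w <= [pred d | tag d == u]} ->
    fsubst (s w) (circuit_poly cfi_circuit) = 1.
  move=> du wd wu; rewrite fsubst_cfi_circuit big1 ?addr0 // => v _.
  (* An entry is the sum modulo 2 of membership in [w] and the shift at [u]; one zero entry kills
     the product of its vertex. *)
  have lay (d' : vertex_eq G) : (w d' (+) (tag d' == u)) = false ->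
      layer (fun t => s w (inr (inl t)) + (at_vertex tag u t)%:R)
        #|edge G| (inl d') = 0.
    move=> wd'; rewrite layerE //= (_ : _ + _ = 0) ?annih0 //.
    case: (w d') (tag d' == u) wd' => [] [] //= _; last by rewrite addr0.
    by rewrite addrr_pchar2 ?mpoly_pchar2.
  have [->|vu] := eqVneq v u.
    by rewrite (bigD1 d) ?du //= lay ?mul0r // wd du eqxx.
  rewrite big_vertex_eq (bigD1 [ffun=> 0]) //= lay ?mul0r //=.
  rewrite (negbTE vu) addbF; apply/negP => /wu.
  by rewrite inE /= (negbTE vu).
clearbody k s; pose d0 : vertex_eq G := existT _ u [ffun=> 0].
pose d1 : vertex_eq G := existT _ u [ffun=> 1].
have d01 : d0 != d1.
  apply/eqP => /eqP; rewrite -tag_eqE /tag_eq eqxx /= tagged_asE => /eqP/ffunP.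
  (* An edge at [u] is required for the constant assignments 0 and 1 to differ. *)
  have /card_gt0P[e _] : (0 < #|edge_at u|)%N by rewrite card_edge_at G3.
  by move=> /(_ e); rewrite !ffunE => /eqP.
have k0 : k (inl (inl d0)) = 1.
  rewrite -(big_pred1_eq +%R d0 (fun d => k (inl (inl d)))) -linE.
  by apply: (circE _ d0) => //= d; rewrite !inE => /eqP ->.
have k1 : k (inl (inl d1)) = 1.
  rewrite -(big_pred1_eq +%R d1 (fun d => k (inl (inl d)))) -linE.
  by apply: (circE _ d1) => //= d; rewrite !inE => /eqP ->.
have := linE (pred2 d0 d1); rewrite (circE _ d0) //=; last 2 first.
- by rewrite eqxx.
- by move=> d; rewrite !inE => /orP[] /eqP ->.
rewrite (bigD1 d0) ?eqxx //= (bigD1 d1) /= ?eqxx ?orbT 1?eq_sym //.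
rewrite big1; last by move=> d /andP[/andP[/orP[]/eqP ->]]; rewrite ?eqxx ?andbF.
rewrite addr0 k0 k1 (addrr_pchar2 (mpoly_pchar2 _)) => /eqP.
by rewrite oner_eq0.
Qed.

(** With N = [cfi_size G], the entries number at most N, the layers at most N + 1 and the vertices
    at most N, so there are at most N + 2(N + 1)N + N + 2 gates. *)
Lemma cfi_circuit_size :
  (ips_size cfi_circuit <= 2 * cfi_size G ^ 2 + 4 * cfi_size G + 2)%N.
Proof.
have GV : (#|G| <= #|vertex_eq G|)%N.
  rewrite -(@card_imset _ _ (fun v => existT _ v [ffun=> 0] : vertex_eq G)) ?max_card //.
  by move=> a b [].
have gates := card_layered_circuit 'F_2 u
  (fun s => inr (inl s) : X + Y)  vertex_eq_surj.
rewrite /ips_size geq_max; apply/andP; split; last by rewrite /cfi_size /X /Y; nia.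
apply: leq_trans gates _.
have EN : #|cfi_index G| = (#|{: vertex_eq G + edge G}| + #|X|)%N.
  exact: card_sum.
set N := cfi_size G; rewrite card_sum in EN *.
have [SN bN] : (#|vertex_eq G| + #|edge G| <= N /\ #|edge G| < N.+1)%N.
  by rewrite /N /cfi_size EN; lia.
have := leq_mul bN SN; lia.
Qed.

End CfiRefutation.

Theorem theorem6p2 (G : nat -> sgraph)
    (G_regular : forall n : nat, regular 3 (G n))
    (G_connected : forall n : nat, connected_graph (G n)) :
  exists p : {poly nat}, forall (n : nat) (u : G n),
    exists C : circuit 'F_2 (cfi_var (G n) + cfi_index (G n)),
      [/\ ips_refutation (cfi u 1) C,
          ips_symmetric (cfi u 1) (edge_flips (G n)) (@flip_act (G n)) C,
          ~ y_linear (circuit_poly C)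
        & (ips_size C <= p.[cfi_size (G n)])%N].
Proof.
exists (2%N%:P * 'X^2 + 4%N%:P * 'X + 2%N%:P) => n u; exists (cfi_circuit u).
split.
- exact: cfi_circuit_refutation.
- exact: cfi_circuit_symmetric.
- exact: cfi_circuit_not_linear.
- by rewrite !hornerD !hornerCM hornerXn hornerX hornerC; apply: cfi_circuit_size.
Qed.
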